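(* Let $G$ and $H$ be graphs. Suppose that $\mathcal{F}$ is a (possibly infinite) collection of graphs such that: (1) $F \to (G,H)$ for every $F \in \mathcal{F}$; (2) every graph $\Gamma$ with $\Gamma \to (G,H)$ contains some graph $F \in \mathcal{F}$. Then: (i) $\mathcal{R}(G,H) \subseteq \{F \in \mathcal{F} : F \text{ is not self-embeddable}\}$; (ii) if every $F \in \mathcal{F}$ is self-embeddable, then $\mathcal{R}(G,H)$ is empty.
   Context: All graphs are simple, countable (finite or countably infinite), and have no isolated vertices; collections of graphs are considered up to isomorphism. A subgraph $H$ of $G$ has $V(H)\subseteq V(G)$ and $E(H)\subseteq E(G)$; it is proper if $E(H)$ is a proper subset of $E(G)$. A graph $G$ (properly) contains $H$ if some (proper) subgraph of $G$ is isomorphic to $H$. A graph is self-embeddable if it properly contains itself, i.e. it is isomorphic to one of its proper subgraphs. We write $F \to (G,H)$ if every red-blue coloring of the edges of $F$ produces a subgraph isomorphic to $G$ with all edges red or a subgraph isomorphic to $H$ with all edges blue. A graph $F$ is $(G,H)$-minimal if $F \to (G,H)$ and no proper subgraph $F'$ of $F$ satisfies $F' \to (G,H)$. $\mathcal{R}(G,H)$ denotes the collection of all $(G,H)$-minimal graphs. *)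

(* Defs.v *)
From mathcomp Require Import all_boot.
From mathcomp Require Import all_classical.

Set Implicit Arguments.
Unset Strict Implicit.
Unset Printing Implicit Defensive.

Local Open Scope classical_set_scope.

(* Simple graphs on a finite or countably infinite vertex set, without
   isolated vertices. *)
Record graph := Graph {
  vertex :> countType;
  adj : vertex -> vertex -> Prop;
  adj_sym : forall x y, adj x y -> adj y x;
  adj_irrefl : forall x, ~ adj x x;
  adj_noisolated : forall x, exists y, adj x y }.

Definition isomorphic (F G : graph) : Prop :=
  exists2 f : F -> G, bijective f & forall x y, adj x y <-> adj (f x) (f y).

(* A subgraph need not be induced; like every graph here, it has no isolated
   vertices. *)
Record subgraph (G : graph) := Subgraph {
  sub_vertex : set G;
  sub_adj : G -> G -> Prop;
  sub_adj_sym : forall x y, sub_adj x y -> sub_adj y x;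
  sub_adj_adj : forall x y, sub_adj x y -> adj x y;
  sub_adj_vertex : forall x y, sub_adj x y -> sub_vertex x;
  sub_adj_noisolated : forall x, sub_vertex x -> exists y, sub_adj x y }.

Section GraphOfSubgraph.
Variables (G : graph) (S : subgraph G).

Definition sub_vertex_type : countType := set_type (sub_vertex S).

Definition adj_of_subgraph (x y : sub_vertex_type) : Prop :=
  sub_adj S (\val x) (\val y).

Lemma adj_of_subgraph_sym x y : adj_of_subgraph x y -> adj_of_subgraph y x.
Proof. exact: sub_adj_sym. Qed.

Lemma adj_of_subgraph_irrefl x : ~ adj_of_subgraph x x.
Proof. by move/sub_adj_adj/adj_irrefl. Qed.

Lemma adj_of_subgraph_noisolated x : exists y, adj_of_subgraph x y.
Proof.
have [y xy] := sub_adj_noisolated (set_mem (valP x)).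
have Sy : y \in sub_vertex S by exact/mem_set/(sub_adj_vertex (sub_adj_sym xy)).
by exists (exist _ y Sy).
Qed.

Definition graph_of_subgraph : graph :=
  Graph adj_of_subgraph_sym adj_of_subgraph_irrefl adj_of_subgraph_noisolated.

End GraphOfSubgraph.

Coercion graph_of_subgraph : subgraph >-> graph.

Definition proper_subgraph (G : graph) (S : subgraph G) : Prop :=
  exists x y : G, adj x y /\ ~ sub_adj S x y.

Definition contains (G H : graph) : Prop :=
  exists S : subgraph G, isomorphic S H.

Definition properly_contains (G H : graph) : Prop :=
  exists2 S : subgraph G, proper_subgraph S & isomorphic S H.

Definition self_embeddable (G : graph) : Prop := properly_contains G G.

(* A colouring assigns a colour to each unordered pair of vertices (true is
   red, false is blue); only its values on edges [set x; y] are ever used. *)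
Definition coloring (F : graph) := set F -> bool.

Definition monochromatic (F : graph) (c : coloring F) (b : bool)
    (S : subgraph F) : Prop :=
  forall x y : F, sub_adj S x y -> c [set x; y] = b.

Definition arrows (F G H : graph) : Prop :=
  forall c : coloring F,
    (exists2 S : subgraph F, isomorphic S G & monochromatic c true S) \/
    (exists2 S : subgraph F, isomorphic S H & monochromatic c false S).

Definition ramsey_minimal (G H F : graph) : Prop :=
  arrows F G H /\
  forall S : subgraph F, proper_subgraph S -> ~ arrows S G H.

(* Collections of graphs are predicates: by universe constraints graph is too
   large to be an argument of set. *)
Definition graph_collection := graph -> Prop.

Definition ramsey_minimal_graphs (G H : graph) : graph_collection :=
  fun F => ramsey_minimal G H F.

Definition empty_collection (A : graph_collection) : Prop :=
  forall F, ~ A F.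

(* Inclusion of collections of graphs considered up to isomorphism. *)
Definition subset_up_to_iso (A B : graph_collection) : Prop :=
  forall F, A F -> exists2 F', B F' & isomorphic F F'.

(* Main.v *)
(* The arrow relation passes from a graph to every graph it embeds in.  Hence
   every embedding into a minimal F of a graph K with K -> (G,H) covers all
   edges of F, and so, there being no isolated vertices, is an isomorphism.
   Applied to the member K of the collection contained in F this gives F = K;
   applied to a proper self-embedding of K followed by K -> F it gives a
   contradiction. *)

Require Import Defs.
From mathcomp Require Import all_boot.
From mathcomp Require Import all_classical.

Set Implicit Arguments.
Unset Strict Implicit.
Unset Printing Implicit Defensive.

Local Open Scope classical_set_scope.

(** Non-edges may go to edges, since subgraphs need not be induced. *)
Definition embedding (K F : graph) (f : K -> F) : Prop :=
  injective f /\ forall x y, adj x y -> adj (f x) (f y).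

Lemma embedding_comp (K L F : graph) (g : L -> F) (f : K -> L) :
  embedding g -> embedding f -> embedding (g \o f).
Proof.
by move=> [gI gE] [fI fE]; split=> [|x y /fE/gE//]; exact: inj_comp.
Qed.

Lemma embedding_val (F : graph) (S : subgraph F) :
  embedding (fun x : S => \val x : F).
Proof. by split=> [|x y /sub_adj_adj//]; exact: val_inj. Qed.

Lemma isomorphic_sym (F K : graph) : isomorphic F K -> isomorphic K F.
Proof.
move=> [f [g fK gK] fE]; exists g; first by exists f.
by move=> x y; rewrite fE !gK.
Qed.

Lemma isomorphic_embedding (F K : graph) :
  isomorphic F K -> exists f : F -> K, embedding f.
Proof.
by move=> [f fB fE]; exists f; split=> [|x y /fE//]; exact: bij_inj.
Qed.

Lemma embedding_isomorphic (K F : graph) (f : K -> F) : embedding f ->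
  (forall u v, adj u v -> exists x y, [/\ adj x y, f x = u & f y = v]) ->
  isomorphic K F.
Proof.
move=> [fI fE] f_edge; exists f; last first.
  (* Adjacency is reflected: by injectivity the edge found over [f x], [f y] is the pair [x], [y]
     itself. *)
  by move=> x y; split=> [/fE//|/f_edge[a [b [ab /fI <- /fI <-]]]].
have f_surj u : exists x, f x = u.
  by have [v /f_edge[x [y [_ xu _]]]] := adj_noisolated u; exists x.
by have [g gK] := choice f_surj; exists g => // x; apply: fI; rewrite gK.
Qed.

Section ImageSubgraph.
Variables (K F : graph) (f : K -> F).
Hypothesis f_emb : embedding f.

(** Only edges coming from [K] are kept, not all those that [F] induces on [range f]; this makes the
    image a copy of [K]. *)
Definition image_adj (u v : F) : Prop :=
  exists x y, [/\ adj x y, f x = u & f y = v].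

Lemma image_adj_sym u v : image_adj u v -> image_adj v u.
Proof. by move=> [x [y [/adj_sym yx xu yv]]]; exists y, x. Qed.

Lemma image_adj_adj u v : image_adj u v -> adj u v.
Proof. by move=> [x [y [xy <- <-]]]; exact: f_emb.2. Qed.

Lemma image_adj_range u v : image_adj u v -> range f u.
Proof. by move=> [x [_ [_ <- _]]]; exists x. Qed.

Lemma image_adj_noisolated u : range f u -> exists v, image_adj u v.
Proof.
by move=> [x _ <-]; have [y xy] := adj_noisolated x; exists (f y), x, y.
Qed.

Definition image_subgraph : subgraph F :=
  Subgraph image_adj_sym image_adj_adj image_adj_range image_adj_noisolated.

Lemma image_subgraph_isomorphic : isomorphic K image_subgraph.
Proof.
have f_in x : f x \in range f by apply/mem_set; exists x.
apply: (@embedding_isomorphic K image_subgraph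
          (fun x => exist _ (f x) (f_in x))); last first.
  by move=> u v [x [y [xy xu yv]]]; exists x, y; split=> //; exact: val_inj.
by split=> [x y [/f_emb.1]|x y xy] //; exists x, y.
Qed.

End ImageSubgraph.

(** A coloring of [F] pulls back along [f], each pair taking the color of its image; a monochromatic
    copy found in [K] is then pushed forward to [F]. *)
Lemma arrows_embedding (K F G H : graph) (f : K -> F) :
  embedding f -> arrows K G H -> arrows F G H.
Proof.
move=> f_emb KGH c.
have push b (L : graph) :
    (exists2 S : subgraph K, isomorphic S L &
       monochromatic (fun A => c (f @` A)) b S) ->
    exists2 S : subgraph F, isomorphic S L & monochromatic c b S.
  move=> [S /isomorphic_sym[g gB gE] Sb].
  (* The copy of [L] in [F] is the image of the composite of [L] to [S] to [K] to [F]. *)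
  have fg_emb : embedding (f \o (fun z => \val (g z) : K)).
    apply: embedding_comp f_emb _.
    apply: embedding_comp (embedding_val S) _.
    by split=> [|x y /gE//]; exact: bij_inj.
  exists (image_subgraph fg_emb).
    exact/isomorphic_sym/image_subgraph_isomorphic.
  move=> _ _ [x [y [/gE xy <- <-]]].
  by rewrite -(Sb _ _ xy) image_setU !image_set1.
by case: (KGH (fun A => c (f @` A))) => /push; [left|right].
Qed.

(** If [f] missed an edge, its image would be a proper subgraph of [F] that still arrows, being a
    copy of [K]. *)
Lemma ramsey_minimal_edge (G H F K : graph) (f : K -> F) :
  ramsey_minimal G H F -> arrows K G H -> embedding f ->
  forall u v, adj u v -> exists x y, [/\ adj x y, f x = u & f y = v].
Proof.
move=> [_ Fmin] KGH f_emb u v uv; apply: contrapT => uvf.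
apply: (Fmin (image_subgraph f_emb)); first by exists u, v.
have [g g_emb] := isomorphic_embedding (image_subgraph_isomorphic f_emb).
exact: arrows_embedding g_emb KGH.
Qed.

Lemma ramsey_minimal_not_self_embeddable (G H F K : graph) (f : K -> F) :
  ramsey_minimal G H F -> arrows K G H -> embedding f -> ~ self_embeddable K.
Proof.
move=> Fmin KGH f_emb [T [x [y [xy Txy]]] /isomorphic_sym KT].
have [g g_emb] := isomorphic_embedding KT.
have TGH := arrows_embedding g_emb KGH.
have fT_emb := embedding_comp f_emb (embedding_val T).
(* [T] arrows because it is a copy of [K], so its embedding into [F] covers the image of the edge
   [x], [y]. Injectivity of [f] then puts that edge in [T], which was chosen to miss it. *)
have [a [b [ab /f_emb.1 ax /f_emb.1 yb]]] :=
  ramsey_minimal_edge Fmin TGH fT_emb (f_emb.2 _ _ xy).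
by apply: Txy; rewrite -ax -yb.
Qed.

Theorem theorem10 (G H : graph) (Fam : graph_collection)
    (Fam_arrows : forall F : graph, Fam F -> arrows F G H)
    (Fam_contained : forall Gamma : graph, arrows Gamma G H ->
       exists2 F : graph, Fam F & contains Gamma F) :
  subset_up_to_iso (ramsey_minimal_graphs G H)
    (fun F : graph => Fam F /\ ~ self_embeddable F) /\
  ((forall F : graph, Fam F -> self_embeddable F) ->
     empty_collection (ramsey_minimal_graphs G H)).
Proof.
have minimal_in_Fam : subset_up_to_iso (ramsey_minimal_graphs G H)
    (fun F : graph => Fam F /\ ~ self_embeddable F).
  move=> F Fmin; have [K FamK [S /isomorphic_sym KS]] := Fam_contained F Fmin.1.
  have [g g_emb] := isomorphic_embedding KS.
  have f_emb := embedding_comp (embedding_val S) g_emb.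
  have KGH := Fam_arrows K FamK.
  exists K.
    split=> //.
    exact: ramsey_minimal_not_self_embeddable Fmin KGH f_emb.
  apply/isomorphic_sym/(embedding_isomorphic f_emb).
  exact: ramsey_minimal_edge Fmin KGH f_emb.
split=> // Fam_self F /minimal_in_Fam[K [FamK notK] _].
exact/notK/Fam_self.
Qed.
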